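(* Let $G=(V,E)$ be a connected graph on $n$ vertices of maximum degree at most $\Delta=O(\mathrm{polylog}\, n)$. Let $s=n^{2/3}$. In the distance query model, $\textsc{Simple}(V,s)$ is a reconstruction algorithm (its output always equals $E$) using $\tilde O(n^{5/3})$ queries in expectation. In addition, $\textsc{Simple}$ can be parallelized using 2 rounds.
   Context: Graph reconstruction: the vertex set $V$ of a hidden connected, undirected, unweighted graph $G=(V,E)$ is given; the algorithm must output exactly $E$. In the distance query model, a query on $a,b$ returns the shortest-path distance $\delta(a,b)$. In the parallel setting, queries are issued in rounds, queries within a round being simultaneous and depending only on previous answers. $\tilde O(f(n))$ means $O(f(n)\cdot\mathrm{polylog} f(n))$. The algorithm $\textsc{Simple}(V,s)$, for an integer $s\in[1,n]$: (1) let $S$ be a sample of $s$ vertices selected uniformly and independently at random from $V$; (2) query $\delta(u,v)$ for all $u\in S$, $v\in V$; (3) let $\hat E$ be the set of unordered pairs $\{a,b\}\subseteq V$, $a\ne b$, with $|\delta(u,a)-\delta(u,b)|\le1$ for all $u\in S$; (4) query $\delta(a,b)$ for every $\{a,b\}\in\hat E$; (5) return the pairs $\{a,b\}\in\hat E$ with $\delta(a,b)=1$. The expectation is over the random sample $S$. *)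

(* Defs.v *)
From HB Require Import structures.
From mathcomp Require Import all_boot all_order all_algebra.
From mathcomp Require Import all_classical all_reals all_analysis.

Set Implicit Arguments.
Unset Strict Implicit.
Unset Printing Implicit Defensive.

Import Order.TTheory GRing.Theory Num.Theory.
Import numFieldNormedType.Exports.

Local Open Scope classical_set_scope.
Local Open Scope ring_scope.

Definition connected_graph (V : finType) (e : rel V) : Prop :=
  [/\ symmetric e, irreflexive e, (0 < #|V|)%N & forall x y : V, connect e x y].

Definition max_degree_le (V : finType) (e : rel V) (D : nat) : Prop :=
  forall v : V, (#|[set w | e v w]%SET| <= D)%N.

Definition edge_set (V : finType) (e : rel V) : {set {set V}} :=
  [set [set p.1; p.2]%SET | p in [pred p : V * V | e p.1 p.2]]%SET.

Definition has_walk (V : finType) (e : rel V) (a b : V) (k : nat) : bool :=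
  [exists p : k.-tuple V, path e a p && (last a p == b)].

(* Shortest-path distance: [find] returns the least k < #|V| for which there is
   a walk with k edges (and the junk value #|V| if b is unreachable from a). *)
Definition dist (V : finType) (e : rel V) (a b : V) : nat :=
  find (has_walk e a b) (iota 0 #|V|).

(* Adaptive algorithms that know V and interact with the hidden graph only
   through queries, one at a time. *)
Inductive query_alg (V Out : Type) : Type :=
| Return of Out
| Query of V & V & (nat -> query_alg V Out).
Arguments Return {V Out}.

Fixpoint output (V Out : Type) (d : V -> V -> nat) (A : query_alg V Out) : Out :=
  match A with
  | Return o => o
  | Query a b k => output d (k (d a b))
  end.

(* All queries issued; repetitions are kept, hence counted. *)
Fixpoint queries (V Out : Type) (d : V -> V -> nat) (A : query_alg V Out) :
    seq (V * V) :=
  match A with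
  | Return _ => [::]
  | Query a b k => (a, b) :: queries d (k (d a b))
  end.

(* Algorithms whose queries are issued in simultaneous batches. *)
Inductive round_alg (V Out : Type) : Type :=
| RReturn of Out
| Round of seq (V * V) & (seq nat -> round_alg V Out).
Arguments RReturn {V Out}.

Definition answers (V : Type) (d : V -> V -> nat) (qs : seq (V * V)) : seq nat :=
  [seq d q.1 q.2 | q <- qs].

Fixpoint round_output (V Out : Type) (d : V -> V -> nat) (P : round_alg V Out) :
    Out :=
  match P with
  | RReturn o => o
  | Round qs k => round_output d (k (answers d qs))
  end.

Fixpoint round_queries (V Out : Type) (d : V -> V -> nat)
    (P : round_alg V Out) : seq (V * V) :=
  match P with
  | RReturn _ => [::]
  | Round qs k => qs ++ round_queries d (k (answers d qs))
  end.

Fixpoint rounds (V Out : Type) (d : V -> V -> nat) (P : round_alg V Out) : nat :=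
  match P with
  | RReturn _ => 0%N
  | Round qs k => (rounds d (k (answers d qs))).+1
  end.

(* P does the work of A on the oracle d in at most r rounds: same output, and
   the same queries with the same multiplicities. *)
Definition parallelizes (V : eqType) (Out : Type) (r : nat) (d : V -> V -> nat)
    (P : round_alg V Out) (A : query_alg V Out) : Prop :=
  [/\ round_output d P = output d A,
      perm_eq (round_queries d P) (queries d A) &
      (rounds d P <= r)%N].

(* Issue the queries qs one after the other, then pass on the list of answers. *)
Fixpoint ask (V Out : Type) (qs : seq (V * V)) (k : seq nat -> query_alg V Out) :
    query_alg V Out :=
  match qs with
  | [::] => k [::]
  | (a, b) :: qs' => Query a b (fun x => ask qs' (fun xs => k (x :: xs)))
  end.

Definition lookup (V : eqType) (qs : seq (V * V)) (ans : seq nat) (a b : V) : nat :=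
  nth 0%N ans (index (a, b) qs).

(* Each unordered pair {a, b}, a <> b, is listed exactly once. *)
Definition unordered_pairs (V : finType) : seq (V * V) :=
  [seq p <- enum {: V * V} | (enum_rank p.1 < enum_rank p.2)%N].

(* The pairs whose distances to every vertex of S, as recorded in t, differ by
   at most 1. *)
Definition candidates (V : finType) (S : seq V) (t : V -> V -> nat) :
    seq (V * V) :=
  [seq p <- unordered_pairs V |
    all (fun u => (t u p.1 <= (t u p.2).+1)%N && (t u p.2 <= (t u p.1).+1)%N) S].

(* The algorithm after its sample S, a list of s vertices, has been drawn. *)
Definition simple (V : finType) (s : nat) (S : s.-tuple V) :
    query_alg V {set {set V}} :=
  let Q := [seq (u, v) | u <- S, v <- enum V] in
  ask Q (fun ans =>
  let Ehat := candidates S (lookup Q ans) in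
  ask Ehat (fun ans' =>
  Return [set [set p.1; p.2]%SET
         | p in [seq p <- Ehat | lookup Ehat ans' p.1 p.2 == 1%N]]%SET)).

(* Under the uniform law on s.-tuple V the s coordinates are independent and
   uniform on V (sampling with replacement). *)
Definition uniform_expectation (R : realType) (T : finType) (X : T -> R) : R :=
  (\sum_(w : T) X w) / #|T|%:R.

Definition expected_queries (R : realType) (V : finType) (s : nat)
    (d : V -> V -> nat) : R :=
  uniform_expectation (fun S : s.-tuple V => (size (queries d (simple S)))%:R).

Definition O_polylog (R : realType) (g : nat -> R) : Prop :=
  exists k : nat,
    (g : nat -> R^o) =O_\oo ((fun n => ln n%:R ^+ k) : nat -> R^o).

Definition tilde_O (R : realType) (g f : nat -> R) : Prop :=
  exists k : nat,
    (g : nat -> R^o) =O_\oo ((fun n => f n * ln (f n) ^+ k) : nat -> R^o).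

(* Main.v *)
Require Import Defs.
From HB Require Import structures.
From mathcomp Require Import all_boot all_order all_algebra.
From mathcomp Require Import all_classical all_reals all_analysis.
From mathcomp Require Import zify ring lra.

Set Implicit Arguments.
Unset Strict Implicit.
Unset Printing Implicit Defensive.

Import Order.TTheory GRing.Theory Num.Theory.
Import numFieldNormedType.Exports.

(* A pair {a, b} survives the filtering step exactly when the sample misses all
   its separators, i.e. the vertices u with |d(u,a) - d(u,b)| >= 2; with k
   separators this has probability (1 - k/n)^s, at most 1/n as soon as
   k >= t = 2 n^(1/3) (ln n + 1).  For a fixed a, at most about Delta^3 t^2
   vertices b have fewer than t separators with a, whence
   s n + n (Delta^3 t^2 + O(1)) queries on average. *)

(** * Shortest-path distance as a metric *)

Section Distance.
Variables (V : finType) (e : rel V).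

Lemma has_walkP (a b : V) (k : nat) :
  reflect (exists p : seq V, [/\ size p = k, path e a p & last a p = b])
          (has_walk e a b k).
Proof.
apply: (iffP existsP) => [[p /andP[ep /eqP lp]]|[p [sp ep lp]]].
  by exists p; rewrite size_tuple.
have sp' : size p == k by rewrite sp.
by exists (Tuple sp'); rewrite /= ep lp eqxx.
Qed.

Lemma dist_le_walk (a b : V) (k : nat) : has_walk e a b k -> dist e a b <= k.
Proof.
move=> h; rewrite /dist; set s := iota 0 #|V|.
(* For [#|V| <= k] the bound is free, since [find] never exceeds the length of the list. *)
have [ltk|lek] := ltnP k #|V|; last first.
  by apply: leq_trans (find_size _ _) _; rewrite size_iota.
rewrite leqNgt; apply/negP => /(before_find 0).
by rewrite nth_iota // add0n h.
Qed.

Hypothesis conn : connected_graph e.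

(** Connectivity gives a path, and its duplicate-free shortening has fewer than [#|V|] edges, so the
    search succeeds and the junk value never occurs. *)
Lemma has_walk_dist (a b : V) : has_walk e a b (dist e a b).
Proof.
have [_ _ _ cab] := conn.
have /connectP[p ep lp] := cab a b.
case: (shortenP ep) lp => p' ep' up' _ lp.
have sp : size p' < #|V|.
  by rewrite -[(size p').+1]/(size (a :: p')) -(card_uniqP up') max_card.
have h : has (has_walk e a b) (iota 0 #|V|).
  apply/hasP; exists (size p'); first by rewrite mem_iota.
  by apply/has_walkP; exists p'.
have := nth_find 0 h; rewrite nth_iota //.
by rewrite -[X in _ < X](size_iota 0) -has_find.
Qed.

Lemma dist_refl (a : V) : dist e a a = 0.
Proof.
by apply/eqP; rewrite -leqn0; apply/dist_le_walk/has_walkP; exists [::].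
Qed.

Lemma dist_sym (a b : V) : dist e a b = dist e b a.
Proof.
have [se _ _ _] := conn.
wlog suff le_ab : a b / dist e a b <= dist e b a.
  by apply/eqP; rewrite eqn_leq !le_ab.
have /has_walkP[p [sp ep lp]] := has_walk_dist b a.
apply/dist_le_walk/has_walkP; exists (rev (belast b p)).
rewrite size_rev size_belast sp; split=> //.
  rewrite -lp rev_path.
  by rewrite (@eq_path _ _ e) // => x y; rewrite [LHS]se.
by case: p {sp ep} lp => [|c p] //= _; rewrite rev_cons last_rcons.
Qed.

Lemma dist_triangle (c a b : V) : dist e a b <= dist e a c + dist e c b.
Proof.
have /has_walkP[p [sp ep lp]] := has_walk_dist a c.
have /has_walkP[q [sq eq lq]] := has_walk_dist c b.
apply/dist_le_walk/has_walkP; exists (p ++ q).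
by rewrite size_cat sp sq cat_path last_cat ep lp.
Qed.

(** Cut a geodesic after [i] edges: by the triangle inequality neither piece can be shortened. *)
Lemma dist_split (a b : V) (i : nat) : i <= dist e a b ->
  exists2 c, dist e a c = i & dist e c b = dist e a b - i.
Proof.
move=> le_i; have /has_walkP[p [sp ep lp]] := has_walk_dist a b.
move: ep lp; rewrite -{1 2}(cat_take_drop i p) cat_path last_cat.
set c := last a _ => /andP[e1 e2] l2.
have le1 : dist e a c <= i.
  by apply/dist_le_walk/has_walkP; exists (take i p); rewrite size_takel ?sp.
have le2 : dist e c b <= dist e a b - i.
  by apply/dist_le_walk/has_walkP; exists (drop i p); rewrite size_drop sp.
have := dist_triangle c a b; exists c; lia.
Qed.

Lemma dist_eq0 (a b : V) : (dist e a b == 0) = (a == b).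
Proof.
apply/eqP/eqP => [d0|->]; last exact: dist_refl.
have := has_walk_dist a b; rewrite d0 => /has_walkP[p [/size0nil-> _]].
exact.
Qed.

Lemma dist_eq1 (a b : V) : (dist e a b == 1) = e a b.
Proof.
have [_ ie _ _] := conn; apply/eqP/idP => [d1|eab].
  have := has_walk_dist a b; rewrite d1 => /has_walkP[[|c [|c' p]] [] //= _].
  by rewrite andbT => eac <-.
have : dist e a b <= 1.
  by apply/dist_le_walk/has_walkP; exists [:: b]; rewrite /= eab.
have : dist e a b != 0 by rewrite dist_eq0; apply: contraTneq eab => ->; rewrite ie.
lia.
Qed.

End Distance.

(** * Counting the vertices that have few separators with a given one *)

Lemma card_bigcup_le (I T : finType) (P : pred I) (F : I -> {set T}) :
  #|\bigcup_(i | P i) F i| <= \sum_(i | P i) #|F i|.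
Proof.
elim/big_rec2: _ => [|i A n _ le_n]; first by rewrite cards0.
by rewrite (leq_trans (leq_card_setU _ _)) // leq_add2l.
Qed.

Section Separators.
Variables (V : finType) (e : rel V).

Definition ball (a : V) (k : nat) : {set V} := [set b | dist e a b <= k].

Definition separators (a b : V) : {set V} :=
  [set u | ~~ ((dist e u a <= (dist e u b).+1) && (dist e u b <= (dist e u a).+1))].

(* The vertices below c in the union of all breadth-first trees rooted at a. *)
Definition descendants (a c : V) : {set V} :=
  [set u | dist e a u == dist e a c + dist e c u].

Hypothesis conn : connected_graph e.
Variable D : nat.
Hypothesis degD : max_degree_le e D.

Lemma card_ball1 (a : V) : #|ball a 1| <= D.+1.
Proof.
have sub : ball a 1 \subset a |: [set w | e a w].
  apply/fintype.subsetP => b; rewrite !inE leq_eqVlt ltnS leqn0 dist_eq1 // dist_eq0 //.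
  by rewrite orbC eq_sym.
apply: leq_trans (subset_leq_card sub) _.
by rewrite cardsU1; have := degD a; case: (_ \notin _) => /=; lia.
Qed.

Lemma card_ball (a : V) (k : nat) : #|ball a k| <= D.+1 ^ k.
Proof.
elim: k => [|k IHk].
  have -> : ball a 0 = [set a].
    by apply/setP => b; rewrite !inE leqn0 dist_eq0 // eq_sym.
  by rewrite cards1.
have sub : ball a k.+1 \subset \bigcup_(c in ball a k) ball c 1.
  apply/fintype.subsetP => b; rewrite inE => db; apply/finset.bigcupP.
  (* The minimum covers the [b] already in the smaller ball, for which [c] is [b] itself. *)
  have [c d1 d2] := @dist_split _ _ conn a b (minn k (dist e a b)) (geq_minr _ _).
  by exists c; rewrite inE ?d1 ?d2; lia.
apply: leq_trans (subset_leq_card sub) _.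
apply: leq_trans (card_bigcup_le _ _) _.
apply: (@leq_trans (\sum_(c in ball a k) D.+1)).
  by apply: leq_sum => c _; exact: card_ball1.
by rewrite sum_nat_const expnSr leq_mul2r IHk orbT.
Qed.

(** A vertex within [r] of [a] is at least [r + 2] away from [b]. *)
Lemma ball_sub_separators (a b : V) (r : nat) :
  2 * r + 2 <= dist e a b -> ball a r \subset separators a b.
Proof.
move=> hr; apply/fintype.subsetP => u; rewrite !inE => du.
have := dist_triangle conn u a b.
by rewrite (dist_sym conn u a); lia.
Qed.

(** A descendant reaches both [a] and [b] through [c], optimally in the case of [a], and [c] is
    nearer to [b] by at least 2. *)
Lemma descendants_sub_separators (a b c : V) :
  dist e c b + 2 <= dist e a c -> descendants a c \subset separators a b.
Proof.
move=> hc; apply/fintype.subsetP => u; rewrite !inE => /eqP du.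
have := dist_triangle conn c u b.
by rewrite (dist_sym conn u a) (dist_sym conn u c); lia.
Qed.

(** All these vertices lie in the ball reaching the farthest of them, which is itself one of the
    small balls. *)
Lemma card_small_balls (a : V) (t : nat) :
  #|[set w | #|ball a (dist e a w)| <= t]| <= t.
Proof.
set W := [set w | _]; have [->|[w0 w0W]] := set_0Vmem W; first by rewrite cards0.
have [w wW wmax] := arg_maxnP (fun w => dist e a w) w0W.
have sub : W \subset ball a (dist e a w).
  by apply/fintype.subsetP => v vW; rewrite inE; exact: wmax.
by apply: leq_trans (subset_leq_card sub) _; have : w \in W by []; rewrite inE.
Qed.

(* With d = dist a b >= 2 and r = (d - 2) / 2, both the ball of radius r about a
   and the descendants of the vertex c at distance r + 2 or r + 3 from a on a
   geodesic to b separate a from b.  So if a and b have at most t separators,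
   c is within distance 3 of one of at most t vertices, and b is one of at most
   t descendants of c. *)
Lemma card_few_separators (a : V) (t : nat) :
  #|[set b | #|separators a b| <= t]| <= D.+1 ^ 3 * t ^ 2 + D.+1.
Proof.
pose W := [set w | #|ball a (dist e a w)| <= t].
pose far := \bigcup_(w in W)
  \bigcup_(c in [set c in ball w 3 | #|descendants a c| <= t]) descendants a c.
have sub : [set b | #|separators a b| <= t] \subset far :|: ball a 1.
  apply/fintype.subsetP => b; rewrite inE => sep_t; rewrite inE orbC inE.
  set d := dist e a b; have [//|d2 /=] := leqP d 1.
  (* [m] absorbs the parity of [d]: with [d = 2 * r + m], [c] lies at distance [r + m >= r + 2] from
     [a] and only [r] from [b]. *)
  pose r := (d - 2)./2; pose m := 2 + odd d.
  have dE : d = 2 * r + m.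
    have := odd_double_half (d - 2); rewrite oddB //= addbF -/r /m -mul2n.
    by case: (odd d) => /=; lia.
  have m23 : 2 <= m <= 3 by rewrite /m; case: (odd d).
  have [|w daw dwb] := @dist_split _ _ conn a b r; first lia.
  have [|c dwc dcb] := @dist_split _ _ conn w b m; first lia.
  have tac := dist_triangle conn w a c; have tab := dist_triangle conn c a b.
  have dac : dist e a c = r + m by lia.
  apply/finset.bigcupP; exists w.
    rewrite inE daw; apply: leq_trans sep_t.
    by apply/subset_leq_card/ball_sub_separators; lia.
  apply/finset.bigcupP; exists c; last by rewrite inE; lia.
  rewrite !inE dwc; apply/andP; split; first lia.
  apply: leq_trans sep_t.
  by apply/subset_leq_card/descendants_sub_separators; lia.
apply: leq_trans (subset_leq_card sub) _.
apply: leq_trans (leq_card_setU _ _) _; apply: leq_add; last exact: card_ball1.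
apply: leq_trans (card_bigcup_le _ _) _.
apply: (@leq_trans (\sum_(w in W) D.+1 ^ 3 * t)); last first.
  by rewrite sum_nat_const -mulnn mulnCA leq_mul2l leq_mul2r card_small_balls !orbT.
apply: leq_sum => w _; apply: leq_trans (card_bigcup_le _ _) _.
apply: (@leq_trans (\sum_(c in [set c in ball w 3 | #|descendants a c| <= t]) t)).
  by apply: leq_sum => c; rewrite inE => /andP[].
rewrite sum_nat_const leq_mul2r; apply/orP; right.
apply: leq_trans (card_ball w 3); apply/subset_leq_card/fintype.subsetP => c.
by rewrite inE => /andP[].
Qed.

End Separators.

(** * Transcripts of batched queries *)

Section Queries.
Variables (V : eqType) (d : V -> V -> nat).

Lemma output_ask (Out : Type) (qs : seq (V * V)) (k : seq nat -> query_alg V Out) :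
  output d (ask qs k) = output d (k (answers d qs)).
Proof. by elim: qs k => [|[a b] qs IHqs] k //=; rewrite IHqs. Qed.

Lemma queries_ask (Out : Type) (qs : seq (V * V)) (k : seq nat -> query_alg V Out) :
  queries d (ask qs k) = qs ++ queries d (k (answers d qs)).
Proof. by elim: qs k => [|[a b] qs IHqs] k //=; rewrite IHqs. Qed.

(** Repeated queries are harmless: [index] picks the first occurrence, and all occurrences have the
    same answer. *)
Lemma lookup_answers (qs : seq (V * V)) (a b : V) :
  (a, b) \in qs -> lookup qs (answers d qs) a b = d a b.
Proof.
by move=> ab; rewrite /lookup (nth_map (a, b)) ?index_mem // nth_index.
Qed.

End Queries.

(** * Output, two-round form and candidate count of [simple] *)

Section Simple.
Variables (V : finType) (s : nat).

Definition sample_queries (S : seq V) : seq (V * V) :=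
  [seq (u, v) | u <- S, v <- enum V].

(** The filter only looks up pairs of the first batch, so the default of [lookup] never shows. *)
Lemma candidates_lookup (d : V -> V -> nat) (S : seq V) :
  candidates S (lookup (sample_queries S) (answers d (sample_queries S)))
  = candidates S d.
Proof.
apply: eq_filter => p; apply: eq_in_all => u uS.
by rewrite !lookup_answers // allpairs_f ?mem_enum.
Qed.

Definition adjacent_candidates (d : V -> V -> nat) (S : seq V) : {set {set V}} :=
  [set [set p.1; p.2] | p in [seq p <- candidates S d | d p.1 p.2 == 1]].

Lemma lookup_candidates (d : V -> V -> nat) (S : seq V) :
  [set [set p.1; p.2] | p in [seq p <- candidates S d |
     lookup (candidates S d) (answers d (candidates S d)) p.1 p.2 == 1]]
  = adjacent_candidates d S.
Proof.
rewrite /adjacent_candidates; congr [set _ | p in pred_of_seq _].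
by apply: eq_in_filter => -[a b] ab /=; rewrite lookup_answers.
Qed.

Lemma output_simple (d : V -> V -> nat) (S : s.-tuple V) :
  output d (simple S) = adjacent_candidates d S.
Proof. by rewrite /simple !output_ask /= candidates_lookup lookup_candidates. Qed.

Lemma queries_simple (d : V -> V -> nat) (S : s.-tuple V) :
  queries d (simple S) = sample_queries S ++ candidates S d.
Proof. by rewrite /simple !queries_ask /= candidates_lookup cats0. Qed.

(** Each [ask] of [simple] becomes one round, as the second batch depends only on the answers to the
    first. *)
Definition simple_rounds (S : s.-tuple V) : round_alg V {set {set V}} :=
  Round (sample_queries S) (fun ans =>
  let Ehat := candidates S (lookup (sample_queries S) ans) in
  Round Ehat (fun ans' =>
  RReturn [set [set p.1; p.2]
          | p in [seq p <- Ehat | lookup Ehat ans' p.1 p.2 == 1]])).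

Lemma simple_rounds_parallelizes (d : V -> V -> nat) (S : s.-tuple V) :
  parallelizes 2 d (simple_rounds S) (simple S).
Proof.
split=> //=; first by rewrite output_simple candidates_lookup lookup_candidates.
by rewrite queries_simple candidates_lookup cats0.
Qed.

Variable e : rel V.
Hypothesis conn : connected_graph e.

(** No sample filters out an edge: by the triangle inequality, distances from [u] to adjacent
    vertices differ by at most 1. *)
Lemma edge_candidate (S : seq V) (p : V * V) :
  e p.1 p.2 -> p \in unordered_pairs V -> p \in candidates S (dist e).
Proof.
move=> ep pV; rewrite mem_filter pV andbT; apply/allP => u _.
have [se _ _ _] := conn.
have d12 : dist e p.1 p.2 = 1 by apply/eqP; rewrite dist_eq1.
have d21 : dist e p.2 p.1 = 1 by rewrite dist_sym.
have := dist_triangle conn p.1 u p.2; have := dist_triangle conn p.2 u p.1.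
lia.
Qed.

Lemma adjacent_candidates_edge_set (S : seq V) :
  adjacent_candidates (dist e) S = edge_set e.
Proof.
have [se ie _ _] := conn; apply/setP => x; apply/imsetP/imsetP => -[p].
  by rewrite mem_filter dist_eq1 // => /andP[ep _] ->; exists p.
rewrite inE => ep ->.
have adj q : e q.1 q.2 -> enum_rank q.1 < enum_rank q.2 ->
    q \in [seq p <- candidates S (dist e) | dist e p.1 p.2 == 1].
  move=> eq lt_q; rewrite mem_filter dist_eq1 // eq /=.
  by apply: edge_candidate => //; rewrite mem_filter lt_q mem_enum.
(* Candidates are listed by increasing rank, so the edge may have to be swapped; equal ranks would
   make it a loop. *)
have [lt_p|lt_p|/val_inj/enum_rank_inj p12] := ltngtP (enum_rank p.1) (enum_rank p.2).
- by exists p; rewrite ?adj.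
- by exists (p.2, p.1); rewrite ?adj //= 1?se // finset.setUC.
- by rewrite p12 ie in ep.
Qed.

(** With [A] the complement of a separator set, this counts the samples that let the pair
    survive. *)
Lemma card_tuple_all (A : {set V}) :
  #|[set S : s.-tuple V | all (fun u => u \in A) S]| = #|A| ^ s.
Proof.
rewrite -[s in RHS]card_ord -card_ffun_on -(card_imset _ (can_inj (@tuple_of_finfunK _ _))).
apply: eq_card => S; rewrite inE; apply/all_tnthP/imsetP.
  move=> SA; exists (finfun_of_tuple S); last by rewrite finfun_of_tupleK.
  by apply/ffun_onP => i; rewrite ffunE.
by move=> [f /ffun_onP fA ->] i; rewrite tnth_mktuple.
Qed.

Lemma sum_size_candidates :
  \sum_(S : s.-tuple V) size (candidates S (dist e))
  <= \sum_(a : V) \sum_(b : V) #|~: separators e a b| ^ s.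
Proof.
rewrite pair_bigA /=.
under eq_bigr => S _ do rewrite size_filter -sum1_count big_mkcond /=.
(* Count samples pair by pair, then enlarge the rank-increasing pairs to all ordered ones, diagonal
   included. *)
rewrite exchange_big /= big_filter big_enum_cond big_mkcond /=.
apply: leq_sum => p _; case: ifP => // _.
rewrite -big_mkcond sum1_card -card_tuple_all; apply/eq_leq/eq_card => S.
by rewrite !inE; apply: eq_all => u; rewrite !inE negbK.
Qed.

End Simple.

Local Open Scope ring_scope.

(** * Expected number of queries *)

Section Expectation.
Variables (R : realType) (V : finType) (e : rel V).
Hypothesis conn : connected_graph e.
Let n := #|V|.

Lemma expected_queries_sum (s : nat) :
  expected_queries R s (dist e) <=
  s%:R * n%:R +
  \sum_(a : V) \sum_(b : V) ((n - #|separators e a b|)%:R / n%:R) ^+ s.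
Proof.
have [_ _ n_gt0 _] := conn.
have nR : 0 < (n%:R : R) by rewrite ltr0n.
rewrite /expected_queries /uniform_expectation card_tuple natrX ler_pdivrMr ?exprn_gt0 //.
rewrite -natr_sum.
under eq_bigr => S _ do
  rewrite queries_simple size_cat size_allpairs size_tuple -cardE.
rewrite big_split /= sum_nat_const card_tuple -/n natrD mulrDl.
apply: lerD; first by rewrite natrM natrX natrM mulrC.
apply: le_trans (_ : (\sum_(a : V) \sum_(b : V) #|~: separators e a b| ^ s)%N%:R <= _).
  by rewrite ler_nat sum_size_candidates.
rewrite natr_sum mulr_suml; apply: ler_sum => a _.
rewrite natr_sum mulr_suml; apply: ler_sum => b _.
by rewrite natrX -exprMn divfK ?gt_eqF // cardsCs finset.setCK.
Qed.

Variable D : nat.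
Hypothesis degD : max_degree_le e D.

(** For each [a], the few [b] with at most [t] separators are charged probability 1, and the others,
    at most [n], are charged [eps] each. *)
Lemma expected_queries_le (s t : nat) (eps : R) : 0 <= eps ->
  (forall k : nat, (t < k <= n)%N -> ((n - k)%:R / n%:R) ^+ s <= eps) ->
  expected_queries R s (dist e) <=
  s%:R * n%:R + n%:R * ((D.+1 ^ 3 * t ^ 2 + D.+1)%:R + n%:R * eps).
Proof.
move=> eps0 heps; apply: le_trans (expected_queries_sum s) _; rewrite lerD2l.
have [_ _ n_gt0 _] := conn.
have cst (c : R) : n%:R * c = \sum_(v : V) c by rewrite sumr_const mulr_natl.
rewrite cst; apply: ler_sum => a _.
rewrite (bigID [pred b | (#|separators e a b| <= t)%N]) /=; apply: lerD.
  apply: le_trans (_ : \sum_(b | (#|separators e a b| <= t)%N) (1 : R) <= _).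
    apply: ler_sum => b _; apply: exprn_ile1; first by rewrite divr_ge0.
    by rewrite ler_pdivrMr ?ltr0n // mul1r ler_nat leq_subr.
  rewrite sumr_const ler_nat; apply: leq_trans (card_few_separators conn degD a t).
  by apply/eq_leq/eq_card => b; rewrite inE.
rewrite cst big_mkcond /=.
apply: ler_sum => b _; case: leqP => //= tb.
by apply: heps; rewrite tb max_card.
Qed.

End Expectation.

(** * Choice of the threshold and asymptotic bound *)

Section Asymptotics.
Variable R : realType.

Definition cube_root (n : nat) : R := n%:R `^ 3%:R^-1.

Lemma powR_cube_root (n k : nat) : n%:R `^ (k%:R / 3%:R) = cube_root n ^+ k.
Proof. by rewrite /cube_root mulrC powRrM powR_mulrn ?powR_ge0. Qed.

Lemma cube_rootK (n : nat) : cube_root n ^+ 3 = n%:R.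
Proof. by rewrite -powR_cube_root divff ?powRr1 ?pnatr_eq0. Qed.

Lemma cube_root_ge1 (n : nat) : (0 < n)%N -> 1 <= cube_root n.
Proof. by move=> n0; rewrite -[leLHS](powRr0 n%:R) ler_powR ?ler1n // invr_ge0. Qed.

(** The cube comes from balls of radius 3, the square from the squared threshold. Adding 1 to the
    logarithm keeps that factor at least 1 for all positive [n], so the bound holds at every
    size. *)
Definition query_bound (Delta : nat -> nat) (n : nat) : R :=
  8%:R * n%:R `^ (5%:R / 3%:R) * (Delta n).+1%:R ^+ 3 * (ln n%:R + 1) ^+ 2.

Lemma ln_nat_ge0 (n : nat) : 0 <= ln n%:R :> R.
Proof. by case: n => [|n]; [rewrite ln0 | rewrite ln_ge0 // ler1n]. Qed.

(* The threshold is chosen so that s k / n >= ln n for every k above it. *)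
Lemma miss_probability (n s k : nat) : (0 < n)%N ->
  `|s%:R - cube_root n ^+ 2| < 1 -> (k <= n)%N ->
  2%:R * cube_root n * (ln n%:R + 1) <= k%:R ->
  ((n - k)%:R / n%:R) ^+ s <= n%:R^-1 :> R.
Proof.
move=> n0 hs kn hk; have x1 := cube_root_ge1 n0; have l0 := ln_nat_ge0 n.
have nR : 0 < (n%:R : R) by rewrite ltr0n.
have xK := cube_rootK n; set x := cube_root n in hs hk x1 xK *; set l := ln _ in hk l0.
(* If [x ^ 2 > 2], then [s > x ^ 2 - 1] suffices; otherwise [s >= 1], because [s = 0] would force
   [x ^ 2 < 1]. *)
have s_ge : x ^+ 2 / 2%:R <= s%:R.
  have [x2|x2] := leP (x ^+ 2) 2%:R; last by move: hs; rewrite ltr_norml; lra.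
  have : (0 < s)%N by case: s hs => // ; rewrite sub0r normrN ger0_norm; nra.
  by rewrite -(ler_nat R); lra.
have lsk : l <= s%:R * (k%:R / n%:R).
  rewrite mulrA ler_pdivlMr // -xK.
  (* The 2 in the threshold cancels the half lost on [s], leaving [x ^ 3 * (l + 1)] with
     [x ^ 3 = n]. *)
  have h1 : x ^+ 2 / 2%:R * (2%:R * x * (l + 1)) <= s%:R * k%:R.
    by apply: ler_pM => //; nra.
  by apply: le_trans h1; rewrite !exprS expr0; nra.
have -> : (n - k)%:R / n%:R = 1 + - (k%:R / n%:R) :> R.
  by rewrite natrB // mulrBl divff // gt_eqF.
apply: le_trans (_ : expR (- (k%:R / n%:R)) ^+ s <= _).
  apply: lerXn2r; rewrite ?nnegrE ?expR_ge0 ?expR_ge1Dx //.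
  by rewrite subr_ge0 ler_pdivrMr // mul1r ler_nat.
rewrite -expRM_natl mulrN expRN lef_pV2 ?posrE ?expR_gt0 //.
by rewrite -[leLHS]lnK ?posrE // ler_expR.
Qed.

Lemma expected_queries_bound (Delta : nat -> nat) (V : finType) (s : nat) (e : rel V) :
  `|s%:R - #|V|%:R `^ (2%:R / 3%:R) : R| < 1 ->
  connected_graph e -> max_degree_le e (Delta #|V|) ->
  expected_queries R s (dist e) <= query_bound Delta #|V|.
Proof.
rewrite /query_bound !powR_cube_root => hs conn deg; have [_ _ n0 _] := conn.
set n := #|V| in hs deg n0 *.
have x1 := cube_root_ge1 n0; have l0 := ln_nat_ge0 n; have xK := cube_rootK n.
pose tau := 2%:R * cube_root n * (ln n%:R + 1).
have tau0 : 0 <= tau by rewrite /tau; nra.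
(* An integer above the truncation is at least [tau], as the miss probability requires, while the
   truncation itself is at most [tau]. *)
have /andP[t_le t_gt] := truncn_itv tau0.
apply: le_trans (expected_queries_le (t := Num.truncn tau) (eps := n%:R^-1) conn deg _ _) _.
- by rewrite invr_ge0.
- move=> k /andP[tk kn]; apply: miss_probability => //.
  by apply: le_trans (ltW t_gt) _; rewrite ler_nat.
rewrite divff ?pnatr_eq0 -?lt0n // natrD natrM !natrX.
set M : R := _.+1%:R; have M1 : 1 <= M by rewrite /M ler1n.
have t2 : (Num.truncn tau)%:R ^+ 2 <= tau ^+ 2.
  by apply: lerXn2r; rewrite ?nnegrE.
have tauE : tau = 2%:R * cube_root n * (ln n%:R + 1) by [].
move: hs tauE t2 x1 xK; set x := cube_root n; set L := ln _ + 1.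
set T := (Num.truncn tau)%:R => hs tauE t2 x1 xK.
have L1 : 1 <= L by rewrite lerDr.
have M3 : M <= M ^+ 3 by rewrite ler_eXnr.
have L21 : 1 <= L ^+ 2 by rewrite exprn_ege1.
have s_le : s%:R <= x ^+ 2 + 1 by move: hs; rewrite ltr_norml; lra.
have x21 : 1 <= x ^+ 2 by rewrite exprn_ege1.
have ML : M <= M ^+ 3 * L ^+ 2.
  by apply: le_trans M3 _; rewrite ler_peMr // exprn_ge0 //; lra.
(* With [Y = x ^ 2 * (M ^ 3 * L ^ 2)], the four terms are at most [2 Y], [4 Y], [Y] and [Y]: hence
   the 8. *)
have X : n%:R * (s%:R + M ^+ 3 * T ^+ 2 + M + 1)
    <= n%:R * (8%:R * (x ^+ 2 * (M ^+ 3 * L ^+ 2))).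
  apply: ler_wpM2l => //.
  have h1 : M ^+ 3 * T ^+ 2 <= M ^+ 3 * tau ^+ 2.
    by apply: ler_wpM2l => //; rewrite exprn_ge0 //; lra.
  have h2 : M ^+ 3 * tau ^+ 2 = 4%:R * (x ^+ 2 * (M ^+ 3 * L ^+ 2)).
    by rewrite tauE; ring.
  have h3 : 1 <= M ^+ 3 * L ^+ 2 by lra.
  have h4 : x ^+ 2 <= x ^+ 2 * (M ^+ 3 * L ^+ 2) by rewrite ler_peMr //; lra.
  have h5 : M ^+ 3 * L ^+ 2 <= x ^+ 2 * (M ^+ 3 * L ^+ 2) by rewrite ler_peMl //; lra.
  lra.
apply: le_trans (le_trans X _); first by rewrite le_eqVlt; apply/orP; left; apply/eqP; ring.
by rewrite le_eqVlt -xK; apply/orP; left; apply/eqP; ring.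
Qed.

Lemma query_bound_tilde_O (Delta : nat -> nat) :
  O_polylog (fun n => (Delta n)%:R : R) ->
  tilde_O (query_bound Delta) (fun n => n%:R `^ (5%:R / 3%:R)).
Proof.
(* The exponent is [3 k] for the cubed degree plus 2 for the squared logarithm; the constant below
   is [8 * 4 * (C + 1) ^ 3]. *)
move=> [k /eqO_exP[C C0 hC]]; exists (3 * k + 2)%N; apply/eqO_exP.
exists (32%:R * (C + 1) ^+ 3); first by rewrite mulr_gt0 // exprn_gt0 // ltr_wpDl // ltW.
near=> m.
have Dm : `|(Delta m)%:R| <= C * `|ln m%:R ^+ k| :> R by near: m.
(* Past [expR 1] the logarithm is at least 1, so the added 1s are absorbed: [l + 1 <= 2 l], and the
   degree plus 1 is at most [(C + 1) * l ^ k]. *)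
have em : expR 1 <= m%:R :> R by near: m; exact: nbhs_infty_ger.
have m0 : 0 < m%:R :> R by apply: lt_le_trans em; exact: expR_gt0.
have l1 : 1 <= ln m%:R :> R by rewrite -ler_expR lnK ?posrE.
rewrite /query_bound ln_powR; set f := powR _ _; set l := ln _ in Dm l1 *.
have f0 : 0 <= f by exact: powR_ge0.
have l0 : 0 <= l by lra.
move: Dm; rewrite !ger0_norm ?exprn_ge0 // => [Dm||]; first last.
- by rewrite !mulr_ge0 // ?exprn_ge0 // addr_ge0.
- by rewrite mulr_ge0 // exprn_ge0 //; lra.
have hD : (Delta m).+1%:R ^+ 3 <= (C + 1) ^+ 3 * l ^+ (3 * k).
  rewrite mulnC exprM -exprMn; apply: lerXn2r; rewrite ?nnegrE //.
    by apply: mulr_ge0; [lra | exact: exprn_ge0].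
  by rewrite -natr1 mulrDl mul1r; apply: lerD => //; exact: exprn_ege1.
have hl : (l + 1) ^+ 2 <= 4%:R * l ^+ 2 by rewrite !expr2; nra.
(* [tilde_O] takes the logarithm of [n ^ (5/3)], which is [5/3] times [l] and so only larger. *)
have hl' : l ^+ (3 * k + 2) <= (5%:R / 3%:R * l) ^+ (3 * k + 2).
  by apply: lerXn2r; rewrite ?nnegrE; lra.
apply: le_trans (_ : 8%:R * f * ((C + 1) ^+ 3 * l ^+ (3 * k)) * (4%:R * l ^+ 2) <= _).
  apply: ler_pM => //; last by apply: ler_wpM2l => //; rewrite mulr_ge0.
    by rewrite !mulr_ge0 // exprn_ge0.
  by rewrite exprn_ge0 // addr_ge0.
have -> : 8%:R * f * ((C + 1) ^+ 3 * l ^+ (3 * k)) * (4%:R * l ^+ 2)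
    = 32%:R * (C + 1) ^+ 3 * (f * l ^+ (3 * k + 2)).
  by rewrite exprD; ring.
apply: ler_wpM2l; first by rewrite mulr_ge0 // exprn_ge0 // addr_ge0 // ltW.
exact: ler_wpM2l.
Unshelve. all: by end_near.
Qed.

End Asymptotics.

Theorem theorem6 (R : realType) (Delta : nat -> nat)
    (hDelta : O_polylog (fun n => (Delta n)%:R : R)) :
  exists2 g : nat -> R,
    tilde_O g (fun n => n%:R `^ (5%:R / 3%:R)) &
    forall (V : finType) (s : nat),
      `|s%:R - #|V|%:R `^ (2%:R / 3%:R) : R| < 1 ->
      exists P : s.-tuple V -> round_alg V {set {set V}},
      forall e : rel V,
        connected_graph e -> max_degree_le e (Delta #|V|) ->
        [/\ forall S : s.-tuple V, output (dist e) (simple S) = edge_set e,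
            expected_queries R s (dist e) <= g #|V| &
            forall S : s.-tuple V, parallelizes 2 (dist e) (P S) (simple S)].
Proof.
exists (query_bound R Delta); first exact: query_bound_tilde_O.
move=> V s hs; exists (@simple_rounds V s) => e conn deg; split=> [S||S].
- by rewrite output_simple adjacent_candidates_edge_set.
- exact: expected_queries_bound.
- exact: simple_rounds_parallelizes.
Qed.
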